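(* For each real number $\alpha$ with $0<\alpha<1$, there exists an infinite word $x\in \{a,b\}^{\mathbb{N}}$ of factor complexity $p_x(n)=O(n^{2 +\alpha})$ such that $c(x)\geq\alpha$.
   Context: For a language $L$ (a set of finite words over a finite alphabet), $p_L(n)$ is the number of words of length $n$ in $L$. For an infinite word $x$, $\mathrm{Fac}(x)$ is the set of all finite blocks of consecutive letters of $x$, including the empty word, and $p_x(n)=p_{\mathrm{Fac}(x)}(n)$. $S^k$ denotes the set of all concatenations of $k$ elements of $S$. For real $\beta\ge 0$, $\mathcal{L}(\beta)$ is the collection of languages $S$ over some finite nonempty alphabet with $p_S(n)=O(n^\beta)$. Define $d_\beta(x)=\inf\{k\ge 1 : \mathrm{Fac}(x)\subseteq S^k \text{ for some } S\in\mathcal{L}(\beta)\}$ and the cost $c(x)=\inf\{\beta\in[0,+\infty) : d_\beta(x)<+\infty\}$, with $\inf\emptyset=+\infty$. *)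

(* Defs.v *)
From HB Require Import structures.
From mathcomp Require Import all_boot all_order all_algebra finmap.
From mathcomp Require Import all_classical all_reals all_analysis.

Set Implicit Arguments.
Unset Strict Implicit.
Unset Printing Implicit Defensive.

Import Order.TTheory GRing.Theory Num.Theory.
Import numFieldNormedType.Exports.

Local Open Scope classical_set_scope.
Local Open Scope ring_scope.

(* Letters live in an ambient type [T]; an alphabet is a finite set of letters
   [A : {fset T}], so that languages over different alphabets can be compared
   with the factors of one infinite word. *)
Definition language (T : Type) := set (seq T).

Definition over_alphabet (T : choiceType) (A : {fset T}) (L : language T) :=
  forall w, L w -> {subset w <= A}.

(* [fset_set] sends infinite sets to the empty one; this never happens for a
   language over a finite alphabet. *)
Definition complexity (T : choiceType) (L : language T) (n : nat) : nat :=
  #|` fset_set [set w | L w /\ size w = n]|.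

Definition poly_growth (R : realType) (beta : R) (p : nat -> nat) : Prop :=
  (fun n => (p n)%:R : R) =O_\oo (fun n => n%:R `^ beta).

Definition Fac (T : Type) (x : nat -> T) : language T :=
  [set w | exists i n, w = mkseq (fun j => x (i + j)%N) n].

Definition lang_pow (T : eqType) (S : language T) (k : nat) : language T :=
  [set flatten ws | ws in [set ws : seq (seq T) |
     size ws = k /\ forall w, w \in ws -> S w]].

Definition lang_class (R : realType) (T : choiceType) (beta : R) :
    set (language T) :=
  [set S | (exists A : {fset T}, A != fset0 /\ over_alphabet A S) /\
           poly_growth beta (complexity S)].

(* [ereal_inf set0 = +oo], as required for both infima below. *)
Definition word_dim (R : realType) (T : choiceType) (beta : R)
    (x : nat -> T) : \bar R :=
  ereal_inf [set k%:R%:E | k in [set k : nat | (1 <= k)%N /\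
    exists2 S : language T, lang_class beta S & Fac x `<=` lang_pow S k]].

Definition cost (R : realType) (T : choiceType) (x : nat -> T) : \bar R :=
  ereal_inf [set beta%:E | beta in
    [set beta : R | 0 <= beta /\ (word_dim beta x < +oo)%E]].

(* Main.v *)
Require Import Defs.
From HB Require Import structures.
From mathcomp Require Import all_boot all_order all_algebra finmap zify ring lra.
From mathcomp Require Import all_classical all_reals all_analysis.

Set Implicit Arguments.
Unset Strict Implicit.
Unset Printing Implicit Defensive.

Import Order.TTheory GRing.Theory Num.Theory.
Import numFieldNormedType.Exports.

(** Every scale [s] contributes to the infinite word the codewords
    [(a^i b a^j b)^(s+1)], where [p = 2^s], [i] runs over [[p, 2p)], and [j]
    over [m] consecutive values starting at [2p], with [m] of the order of
    [p^alpha / (s+1)]. The word [x] is the concatenation of all of them, scale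
    after scale.

    Upper bound on the complexity. Scale [s] has [p m] codewords of length
    [O(p (s+1))], so its total length is [O(p^(2+alpha))], and so is the length
    of the prefix [Q] formed by all scales up to [s], as these lengths grow
    geometrically. Let [2^t <= n < 2^(t+1)]. A factor of length [n] either
    starts inside the prefix [Q] formed by scales up to [t], which leaves
    [O(n^(2+alpha))] possibilities, or starts beyond it. In the second case all
    the gaps between letters [b] exceed [n], so the factor contains at most one
    [b], and there are only [n+1] such words ([complexity_coding_word],
    [size_prefix_word_le]).

    Lower bound on the cost. Suppose that [Fac x] lies in [S^k] with
    [p_S(n) = O(n^beta)] and [beta < alpha]. When [s >= 4k], one of the [k]
    pieces of a codeword of scale [s] spans at least two periods of it
    ([long_piece]). Such a piece shows both gaps of the codeword, and because
    [i < j] for all pairs of the scale, it determines the pair [(i, j)]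
    ([codeword_inj]). Hence [S] has at least [p m] words of length at most
    [6 p (s+1)] ([sum_complexity_ge]). The growth of [S] allows only
    [O((p (s+1))^(1+beta))] of them, whereas [p m] is at least
    [p^(1+alpha) / (s+1)]. As [p = 2^s] dominates every power of [s+1], this is
    absurd for large [s] ([coding_word_not_sub]). The number [s+1] of
    repetitions is thus unbounded, to defeat every [k], and yet negligible in
    front of every positive power of [p]. *)

(** * Periodic patterns with two marks per period *)

Section Marks.
Variables (i j : nat).
Let l := (i + j).+2.

(** The positions of the letter [b] in the periodic word of period
    [a^i b a^j b]. *)
Definition marked t := (t %% l == i) || (t %% l == (i + j).+1).

Lemma mod_after_left t e : t %% l = i -> e <= j.+1 -> (t + e) %% l = i + e.
Proof. by move=> ti le_e; rewrite -modnDml ti modn_small // /l; lia. Qed.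

Lemma mod_after_right t e : t %% l = (i + j).+1 -> e <= i ->
  (t + e.+1) %% l = e.
Proof.
move=> tj le_e; rewrite -modnDml tj (_ : _ + _ = l + e); last by rewrite /l; lia.
by rewrite modnDl modn_small // /l; lia.
Qed.

Lemma gap_marked t d : 0 < d -> marked t -> marked (t + d) ->
  (forall e, 0 < e < d -> ~~ marked (t + e)) -> d = i.+1 \/ d = j.+1.
Proof.
move=> d0 /orP[]/eqP ht md btw.
- right; case: (ltngtP d j.+1) => // [lt_d|lt_d].
    by move: md; rewrite /marked (mod_after_left ht (ltnW lt_d)); lia.
  by have := btw j.+1 lt_d; rewrite /marked (mod_after_left ht (leqnn _)); lia.
- left; case: (ltngtP d i.+1) => // [lt_d|lt_d].
    by move: md; rewrite -(prednK d0) /marked (mod_after_right ht); lia.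
  by have := btw i.+1 lt_d; rewrite /marked (mod_after_right ht (leqnn _)); lia.
Qed.

Lemma marked_left t : t %% l = i -> [/\ marked t, marked (t + j.+1) &
  forall e, 0 < e < j.+1 -> ~~ marked (t + e)].
Proof.
move=> ht; split=> [||e /andP[e0 lt_e]]; rewrite /marked.
- by rewrite ht eqxx.
- by rewrite (mod_after_left ht) // addnS eqxx orbT.
- by rewrite (mod_after_left ht (ltnW lt_e)); lia.
Qed.

Lemma marked_right t : t %% l = (i + j).+1 -> [/\ marked t, marked (t + i.+1) &
  forall e, 0 < e < i.+1 -> ~~ marked (t + e)].
Proof.
move=> ht; split=> [||[//|e] /= lt_e]; rewrite /marked.
- by rewrite ht eqxx orbT.
- by rewrite (mod_after_right ht) // eqxx.
- by rewrite (mod_after_right ht (ltnW lt_e)); lia.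
Qed.

Lemma mod_reachable o r : r < l -> exists2 u, u < l & (o + u) %% l = r.
Proof.
move=> lt_r; have lt_o := ltn_pmod o (ltn0Sn (i + j).+1).
exists ((r + (l - o %% l)) %% l); first exact: ltn_pmod.
rewrite modnDmr -modnDml (_ : _ + _ = l + r); last by rewrite /l in lt_o *; lia.
by rewrite modnDl modn_small.
Qed.
End Marks.

(** * Words spelled by their gaps *)

Section Spelling.
Variables (T : eqType) (a b : T).

(** Encoding words by the sizes of their blocks of [a] turns the sparsity of
    the letter [b] into a lower bound on the entries of a list. *)
Definition spell (gs : seq nat) : seq T :=
  flatten [seq rcons (nseq g a) b | g <- gs].

Lemma spell_cat gs hs : spell (gs ++ hs) = spell gs ++ spell hs.
Proof. by rewrite /spell map_cat flatten_cat. Qed.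

Lemma size_spell gs : size (spell gs) = \sum_(g <- gs) g.+1.
Proof.
rewrite size_flatten /shape -map_comp sumnE big_map.
by apply: eq_bigr => g _; rewrite /= size_rcons size_nseq.
Qed.

Lemma nth_spell_cons g gs v :
  nth a (spell (g :: gs)) v =
  if v < g then a else if v == g then b else nth a (spell gs) (v - g.+1).
Proof.
rewrite /spell /= -/(spell gs) nth_cat size_rcons size_nseq ltnS.
case: ltngtP => [lt_vg|lt_gv|->]; last by rewrite nth_rcons size_nseq ltnn eqxx.
  by rewrite nth_rcons size_nseq lt_vg nth_nseq lt_vg.
by [].
Qed.

(** The bound on the first [b] is what makes the bound on distances inductive:
    it controls the distance from the last letter of a block to the next [b]. *)
Lemma spell_sparse p gs : a != b -> all (leq p) gs ->
  (forall v, nth a (spell gs) v = b -> p <= v) /\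
  (forall u v, nth a (spell gs) u = b -> nth a (spell gs) v = b ->
     u < v -> u + p < v).
Proof.
move=> /eqP hab; elim: gs => [|g gs IH] /=.
  by move=> _; split=> [v|u v]; rewrite nth_nil => /hab.
case/andP => le_pg /IH [first_b next_b].
split=> [v|u v]; rewrite !nth_spell_cons.
  by case: ltngtP => // [lt_gv _|->] //; apply: leq_trans (ltnW lt_gv).
case: (ltngtP u g) => [_|lt_gu|->]; first by move=> /hab.
- case: (ltngtP v g) => [_ _|lt_gv|->]; [by move=> /hab| | by lia].
  by move=> bu bv lt_uv; have := next_b _ _ bu bv; lia.
- case: (ltngtP v g) => [_ _|lt_gv|->]; [by move=> /hab| | by lia].
  by move=> _ /first_b; lia.
Qed.

Lemma nth_flatten_nseq (x0 : T) K c u :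
  u < K * size c -> nth x0 (flatten (nseq K c)) u = nth x0 c (u %% size c).
Proof.
elim: K u => [|K IH] u //=; rewrite mulSn nth_cat.
case: (ltnP u (size c)) => [lt_u _|le_u lt_u]; first by rewrite modn_small.
rewrite IH; last by rewrite ltn_subLR.
by rewrite -{2}(subnK le_u) modnDr.
Qed.

Definition codeword K i j := spell (flatten (nseq K [:: i; j])).

Lemma codewordE K i j : codeword K i j = flatten (nseq K (spell [:: i; j])).
Proof.
elim: K => //= K IH.
by rewrite /codeword /= -[i :: j :: _]/([:: i; j] ++ _) spell_cat -IH.
Qed.

Lemma size_codeword K i j : size (codeword K i j) = K * (i + j).+2.
Proof.
rewrite codewordE size_flatten /shape map_nseq sumn_nseq size_spell.
by rewrite !big_cons big_nil; lia.
Qed.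

Lemma nth_codeword K i j u : a != b -> u < K * (i + j).+2 ->
  (nth a (codeword K i j) u == b) = marked i j u.
Proof.
move=> hab; have sz : size (spell [:: i; j]) = (i + j).+2.
  by rewrite size_spell !big_cons big_nil; lia.
rewrite codewordE -{1}sz => lt_u; rewrite nth_flatten_nseq // sz /marked.
move: (u %% _) (ltn_pmod u (ltn0Sn (i + j).+1)) => r lt_r.
rewrite !nth_spell_cons nth_nil.
case: (ltngtP r i) => [lt_ri|lt_ir|->]; last by rewrite !eqxx.
  by rewrite (negbTE hab); lia.
by case: (ltngtP (r - i.+1) j) => [?|?|?]; rewrite ?(negbTE hab) ?eqxx; lia.
Qed.

Definition is_gap (v : seq T) (d : nat) :=
  exists u, [/\ u + d < size v, 0 < d, nth a v u == b, nth a v (u + d) == b &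
    forall e, 0 < e < d -> nth a v (u + e) != b].

Definition occurs_at (v w : seq T) o :=
  o + size v <= size w /\ forall u, u < size v -> nth a v u = nth a w (o + u).

Lemma occurs_at_marked K i j v o u : a != b -> occurs_at v (codeword K i j) o ->
  u < size v -> (nth a v u == b) = marked i j (o + u).
Proof.
move=> hab [+ nthv] lt_u; rewrite size_codeword => le_o.
by rewrite nthv // nth_codeword //; lia.
Qed.

(** Together with [codeword_gaps], this shows that a long enough factor [v] of
    a codeword has exactly the gaps [i.+1] and [j.+1]: an invariant of [v] alone,
    whatever the phase at which [v] is cut out. *)
Lemma gap_codeword K i j v o d : a != b -> occurs_at v (codeword K i j) o ->
  is_gap v d -> d = i.+1 \/ d = j.+1.
Proof.
move=> hab occ [u [lt_ud d0 bu bd btw]].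
apply: (@gap_marked i j (o + u)) => //.
- by rewrite -(occurs_at_marked hab occ) //; lia.
- by rewrite -addnA -(occurs_at_marked hab occ).
- move=> e he; rewrite -addnA -(occurs_at_marked hab occ) ?btw //; lia.
Qed.

(** Within one period after the start of [v] there is a [b] of each of the two
    kinds, and the [b] that follows it comes within another period. *)
Lemma codeword_gaps K i j v o : a != b -> occurs_at v (codeword K i j) o ->
  2 * (i + j).+2 <= size v -> is_gap v i.+1 /\ is_gap v j.+1.
Proof.
move=> hab occ le_v.
have gap u d : u < (i + j).+2 -> 0 < d <= (i + j).+1 -> marked i j (o + u) ->
    marked i j (o + u + d) -> (forall e, 0 < e < d -> ~~ marked i j (o + u + e)) ->
    is_gap v d.
  move=> lt_u /andP[d0 le_d] mu md btw; exists u; split=> //.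
  - by lia.
  - by rewrite (occurs_at_marked hab occ) //; lia.
  - by rewrite (occurs_at_marked hab occ) ?addnA //; lia.
  - by move=> e he; rewrite (occurs_at_marked hab occ) ?addnA ?btw //; lia.
split.
  have [u lt_u /marked_right[m0 m1 btw]] := @mod_reachable i j o (i + j).+1 ltac:(lia).
  by apply: (gap u) => //; lia.
have [u lt_u /marked_left[m0 m1 btw]] := @mod_reachable i j o i ltac:(lia).
by apply: (gap u) => //; lia.
Qed.

(** Both [i+1] and [j+1] are gaps of [v], and every gap of [v] is [i'+1] or
    [j'+1]; the inequalities between the indices exclude the exchange of the two. *)
Lemma codeword_inj K K' i j i' j' v o o' : a != b -> i < j' -> i' < j ->
  occurs_at v (codeword K i j) o -> occurs_at v (codeword K' i' j') o' ->
  2 * (i + j).+2 <= size v -> i = i' /\ j = j'.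
Proof.
move=> hab lt_ij' lt_i'j occ occ' le_v.
have [gi gj] := codeword_gaps hab occ le_v.
by have := gap_codeword hab occ' gi; have := gap_codeword hab occ' gj; lia.
Qed.

Lemma mem_flatten_occurs (ws : seq (seq T)) v : v \in ws ->
  exists o, occurs_at v (flatten ws) o.
Proof.
move=> /path.splitPr[ws1 ws2]; exists (size (flatten ws1)).
rewrite flatten_cat /= /occurs_at !size_cat; split=> [|u lt_u]; first by lia.
by rewrite !nth_cat ltnNge leq_addr /= addKn lt_u.
Qed.

Lemma long_piece (ws : seq (seq T)) B : size ws * B < size (flatten ws) ->
  exists2 v, v \in ws & B < size v.
Proof.
move=> lt_B; case: (boolP (has (fun v => B < size v) ws)) => [/hasP//|/hasPn no].
suff : size (flatten ws) <= size ws * B by lia.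
elim: ws no {lt_B} => //= w ws IH no; rewrite size_cat mulSn leq_add //.
  by rewrite leqNgt no ?mem_head.
by apply: IH => v vws; rewrite no // inE vws orbT.
Qed.
End Spelling.

(** * The infinite word *)

Section InfiniteWord.
Variables (m : nat -> nat).
Hypothesis m_gt0 : forall s, 0 < m s.

(** All [i] precede all [j], so that the unordered pair of gaps determines
    the ordered one. *)
Definition scale_pairs s : seq (nat * nat) :=
  [seq (i, j) | i <- iota (2 ^ s) (2 ^ s), j <- iota (2 * 2 ^ s) (m s)].

Definition scale_gaps s : seq nat :=
  flatten [seq flatten (nseq s.+1 [:: ij.1; ij.2]) | ij <- scale_pairs s].

Definition gaps_from s n : seq nat := flatten [seq scale_gaps r | r <- iota s n].

Lemma gaps_from_ge s n : all (leq (2 ^ s)) (gaps_from s n).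
Proof.
apply/allP => g /flattenP[_ /mapP[r r_in ->] /flattenP[_ /mapP[ij ij_in ->]]].
move=> /flattenP[_ /nseqP[-> _]]; move: r_in ij_in.
rewrite mem_iota => /andP[le_sr _] /allpairsP[[i j] /= [+ + ->]] /=.
rewrite !mem_iota => /andP[le_i _] /andP[le_j _].
have : 2 ^ s <= 2 ^ r by rewrite leq_exp2l.
by rewrite !inE => + /orP[]/eqP->; move: le_i le_j => /=; lia.
Qed.

Lemma scale_gaps_neq0 s : 0 < size (scale_gaps s).
Proof.
suff : 2 ^ s \in scale_gaps s by case: (scale_gaps s).
have p_gt0 : 0 < 2 ^ s by rewrite expn_gt0.
apply/flattenP; exists (flatten (nseq s.+1 [:: 2 ^ s; 2 * 2 ^ s])).
  2: exact: mem_head.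
apply/mapP; exists (2 ^ s, 2 * 2 ^ s) => //.
apply/allpairsP; exists (2 ^ s, 2 * 2 ^ s); rewrite /= !mem_iota.
by have := m_gt0 s; split=> //; lia.
Qed.

Variables (T : eqType) (a b : T).

Definition prefix_word n : seq T := spell a b (gaps_from 0 n).

Lemma prefix_wordD n k :
  prefix_word (n + k) = prefix_word n ++ spell a b (gaps_from n k).
Proof. by rewrite -spell_cat /prefix_word /gaps_from iotaD map_cat flatten_cat. Qed.

Lemma prefix_wordS n :
  prefix_word n.+1 = prefix_word n ++ spell a b (scale_gaps n).
Proof. by rewrite -addn1 prefix_wordD /gaps_from /= cats0. Qed.

Lemma size_prefix_word n : n <= size (prefix_word n).
Proof.
elim: n => // n IH; rewrite prefix_wordS size_cat -addn1 leq_add //.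
rewrite size_spell.
by have := scale_gaps_neq0 n; case: (scale_gaps n) => // g gs _; rewrite big_cons.
Qed.

(** Letter [n] is read in the [n.+1]-st prefix, which is long enough because
    each scale adds at least one letter. *)
Definition coding_word n : T := nth a (prefix_word n.+1) n.

Lemma coding_wordE u n : u < size (prefix_word n) ->
  coding_word u = nth a (prefix_word n) u.
Proof.
have H k l : u < size (prefix_word k) ->
    nth a (prefix_word (k + l)) u = nth a (prefix_word k) u.
  by move=> lt_u; rewrite prefix_wordD nth_cat lt_u.
move=> lt_u; rewrite /coding_word.
by case/orP: (leq_total u.+1 n) => /subnKC <-; rewrite H // size_prefix_word.
Qed.

Lemma coding_word_mem n : coding_word n \in [:: a; b].
Proof.
suff mem gs u : nth a (spell a b gs) u \in [:: a; b] by exact: mem.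
elim: gs u => [|g gs IH] u; first by rewrite nth_nil mem_head.
by rewrite nth_spell_cons; case: ifP => _; rewrite ?mem_head //;
  case: ifP => _; [rewrite !inE eqxx orbT | exact: IH].
Qed.

Lemma coding_word_sparse t u v : a != b -> size (prefix_word t) <= u < v ->
  coding_word u = b -> coding_word v = b -> u + 2 ^ t < v.
Proof.
move=> hab /andP[le_u lt_uv].
have lt_v : v < size (prefix_word (t + v.+1)).
  by apply: leq_trans (size_prefix_word _); lia.
rewrite !(@coding_wordE _ (t + v.+1)) //; last by lia.
rewrite prefix_wordD !nth_cat !ifF; [|by lia|by lia].
have [_ next_b] := spell_sparse hab (gaps_from_ge t v.+1).
by move=> bu bv; have := next_b _ _ bu bv; lia.
Qed.

(** The value [r = n] gives the word [a^n], so that the words with at most one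
    [b] form a single family. *)
Definition one_mark n r : seq T := mkseq (fun j => if j == r then b else a) n.

Lemma factor_one_mark t i n : a != b -> n <= 2 ^ t -> size (prefix_word t) <= i ->
  exists2 r, r <= n & mkseq (fun j => coding_word (i + j)) n = one_mark n r.
Proof.
move=> hab le_n le_i.
have ab u : coding_word u != b -> coding_word u = a.
  by have := coding_word_mem u; rewrite !inE => /orP[]/eqP-> //; rewrite eqxx.
case: (boolP (has (fun j => coding_word (i + j) == b) (iota 0 n))).
  move=> /hasP[r]; rewrite mem_iota => /andP[_ lt_r] /eqP br.
  exists r; first by rewrite ltnW.
  apply/eq_in_map => u; rewrite mem_iota => /andP[_ lt_u].
  case: eqVneq => [->//|ne_ur]; apply: ab; apply/eqP => bu.
  case: (ltngtP u r) => [lt|lt|/eqP]; last by rewrite (negbTE ne_ur).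
    by have := @coding_word_sparse t (i + u) (i + r) hab _ bu br; lia.
  by have := @coding_word_sparse t (i + r) (i + u) hab _ br bu; lia.
move=> /hasPn no; exists n => //; apply/eq_in_map => u u_in.
rewrite ab ?no //; case: eqVneq u_in => // ->; by rewrite mem_iota; lia.
Qed.

Lemma spell_scale_gaps s : spell a b (scale_gaps s) =
  flatten [seq codeword a b s.+1 ij.1 ij.2 | ij <- scale_pairs s].
Proof.
rewrite /scale_gaps; elim: (scale_pairs s) => //= ij l <-.
by rewrite -spell_cat.
Qed.

Lemma codeword_prefix s i j : (i, j) \in scale_pairs s ->
  exists o, occurs_at a (codeword a b s.+1 i j) (prefix_word s.+1) o.
Proof.
move=> ij_in; have [ofs [le_o nth_o]] : exists ofs,
    occurs_at a (codeword a b s.+1 i j) (spell a b (scale_gaps s)) ofs.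
  rewrite spell_scale_gaps; apply: mem_flatten_occurs.
  by apply/mapP; exists (i, j).
exists (size (prefix_word s) + ofs); rewrite prefix_wordS.
split=> [|u lt_u]; first by rewrite size_cat; lia.
by rewrite nth_o // nth_cat -addnA addKn ifF //; lia.
Qed.

(** Each of the [2^s * m s] codewords of scale [s] has gaps less than [2 * 2^s]
    and at most [3 * 2^s], hence a period of at most [6 * 2^s] letters. *)
Lemma size_prefix_wordS s : m s <= (2 ^ s).+1 ->
  size (prefix_word s.+1) <=
    size (prefix_word s) + 6 * 2 ^ s * 2 ^ s * (m s * s.+1).
Proof.
move=> le_m; rewrite prefix_wordS size_cat leq_add2l spell_scale_gaps.
rewrite size_flatten /shape -map_comp sumnE big_map.
apply: (@leq_trans (\sum_(ij <- scale_pairs s) s.+1 * (6 * 2 ^ s))).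
  rewrite big_seq [leqRHS]big_seq; apply: leq_sum => _ /allpairsP[[i j] /= [+ + ->]].
  by rewrite size_codeword !mem_iota leq_mul2l /=; lia.
rewrite big_const_seq count_predT iter_addn_0 size_allpairs !size_iota; lia.
Qed.

End InfiniteWord.

Local Open Scope classical_set_scope.

(** * Complexity as a count *)

Section Complexity.
Variable T : choiceType.

Lemma complexity_le (L : language T) n (s : seq (seq T)) :
  (forall w, L w -> size w = n -> w \in s) -> (complexity L n <= size s)%N.
Proof.
move=> sub; have sub' : [set w | L w /\ size w = n] `<=` [set` s].
  by move=> w [/sub]; apply.
have fin := sub_finite_set sub' (finite_seq s).
rewrite (leq_trans _ (size_undup s)) // -card_fseq.
apply: fsubset_leq_card; apply/fsubsetP => w.
by rewrite in_fset_set // inE in_fset => -[/sub]; apply.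
Qed.

Lemma finite_words (A : {fset T}) n :
  finite_set [set w : seq T | {subset w <= A} /\ size w = n].
Proof.
elim: n => [|n IH].
  by apply: (sub_finite_set _ (finite_set1 [::])) => -[|x w] [].
apply: (sub_finite_set _ (finite_image2 cons (finite_fset A) IH)).
move=> [|x w] [subA] //= [sz]; exists x; first by apply: subA; exact: mem_head.
by exists w => //; split=> // y yw; apply: subA; rewrite inE yw orbT.
Qed.

(** The alphabet matters here: without finiteness of the set of words of
    length [n], its [fset_set] would be empty. *)
Lemma size_le_complexity (A : {fset T}) (S : language T) n (s : seq (seq T)) :
  over_alphabet A S -> uniq s -> (forall w, w \in s -> S w /\ size w = n) ->
  (size s <= complexity S n)%N.
Proof.
move=> SA us sS.
have fin : finite_set [set w | S w /\ size w = n].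
  by apply: (sub_finite_set _ (finite_words A n)) => w [/SA].
rewrite -(undup_id us) -card_fseq; apply: fsubset_leq_card.
by apply/fsubsetP => w; rewrite in_fset in_fset_set // => /sS ?; apply/mem_set.
Qed.

Lemma size_le_sum_complexity (A : {fset T}) (S : language T) L (s : seq (seq T)) :
  over_alphabet A S -> uniq s -> (forall w, w \in s -> S w /\ (size w < L)%N) ->
  (size s <= \sum_(n < L) complexity S n)%N.
Proof.
move=> SA; elim: L s => [|L IH] s us sS.
  by rewrite big_ord0; case: s sS {us} => // w s /(_ w (mem_head _ _))[].
rewrite big_ord_recr /= -(count_predC (fun w => size w < L)%N s) leq_add //.
  rewrite -size_filter IH ?filter_uniq // => w.
  by rewrite mem_filter => /andP[? /sS[]].
rewrite -size_filter (size_le_complexity SA) ?filter_uniq // => w.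
rewrite mem_filter /= => /andP[ge_L /sS[Sw lt_L]]; split=> //.
by apply/eqP; rewrite eqn_leq -ltnS lt_L leqNgt.
Qed.
End Complexity.

(** * Counting factors and pieces *)

Section Bounds.
Variables (m : nat -> nat) (T : choiceType) (a b : T).
Hypotheses (m_gt0 : forall s, (0 < m s)%N) (hab : a != b).
Let x := coding_word m a b.

(** Factors starting inside the prefix are counted by their position; those
    starting beyond it are too short to meet two letters [b]. *)
Lemma complexity_coding_word t n : (n <= 2 ^ t)%N ->
  (complexity (Fac x) n <= size (prefix_word m a b t) + n.+1)%N.
Proof.
move=> le_n.
have := @complexity_le T (Fac x) n
  ([seq mkseq (fun j => x (i + j)%N) n | i <- iota 0 (size (prefix_word m a b t))]
   ++ [seq one_mark a b n r | r <- iota 0 n.+1]).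
rewrite size_cat !size_map !size_iota; apply=> _ [i [n' ->]].
rewrite size_mkseq => ->; rewrite mem_cat.
case: (ltnP i (size (prefix_word m a b t))) => [lt_i|le_i].
  by apply/orP; left; apply/mapP; exists i; rewrite // mem_iota.
have [r le_r ->] := factor_one_mark m_gt0 hab le_n le_i.
by apply/orP; right; apply/mapP; exists r; rewrite // mem_iota.
Qed.

Lemma codeword_Fac s i j : (i, j) \in scale_pairs m s ->
  Fac x (codeword a b s.+1 i j).
Proof.
move=> /(codeword_prefix a b) [ofs [le_o nth_o]].
exists ofs, (size (codeword a b s.+1 i j)).
apply: (@eq_from_nth _ a) => [|u lt_u]; first by rewrite size_mkseq.
by rewrite nth_mkseq // nth_o // -(coding_wordE m_gt0) //
  (leq_trans _ le_o) // ltn_add2l.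
Qed.

(** Each pair of scale [s] receives a long piece [v], an element of [S], of the
    corresponding codeword; these pieces are pairwise distinct. *)
Lemma sum_complexity_ge (A : {fset T}) (S : language T) k s :
  over_alphabet A S -> Fac x `<=` lang_pow S k -> (4 * k <= s)%N ->
  (m s <= (2 ^ s).+1)%N ->
  (2 ^ s * m s <= \sum_(n < (6 * 2 ^ s * s.+1).+1) complexity S n)%N.
Proof.
move=> SA Sk le_k le_m.
have p_gt0 : (0 < 2 ^ s)%N by rewrite expn_gt0.
have /choice [v vP] : forall ij : nat * nat, exists v : seq T,
    ij \in scale_pairs m s -> [/\ S v, (12 * 2 ^ s < size v)%N &
      exists ofs, occurs_at a v (codeword a b s.+1 ij.1 ij.2) ofs].
  move=> [i j]; case: (boolP ((i, j) \in scale_pairs m s)); last by exists [::].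
  move=> ij_in; have [ws [sz_ws ws_S] ws_w] := Sk _ (codeword_Fac ij_in).
  (* [12 * 2^s] is twice the bound on the period, and the codeword has
     [s.+1 > 4 * k] periods of length at least [3 * 2^s]. *)
  have [v v_in lt_v] : exists2 v, v \in ws & (12 * 2 ^ s < size v)%N.
    apply: long_piece; rewrite ws_w sz_ws size_codeword.
    move: ij_in => /allpairsP[[i' j'] /= [+ + [-> ->]]]; rewrite !mem_iota.
    by move: p_gt0 le_k; set p := (2 ^ s)%N; nia.
  exists v => _; split; [exact: ws_S | by [] |].
  by rewrite -ws_w; exact: mem_flatten_occurs.
have bounds i j : (i, j) \in scale_pairs m s ->
    [/\ (i < 2 * 2 ^ s)%N, (2 * 2 ^ s <= j)%N & (j <= 3 * 2 ^ s)%N].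
  by move=> /allpairsP[[i' j'] /= [+ + [-> ->]]]; rewrite !mem_iota; split; lia.
have v_inj : {in scale_pairs m s &, injective v}.
  move=> [i j] [i' j'] ij_in ij'_in eq_v.
  have [_ lt_v [ofs occ]] := vP _ ij_in; have [_ _ [ofs' occ']] := vP _ ij'_in.
  rewrite -eq_v in occ'.
  have [? ? ?] := bounds _ _ ij_in; have [? ? ?] := bounds _ _ ij'_in.
  have le_v : (2 * (i + j).+2 <= 12 * 2 ^ s)%N by lia.
  by have [||| /= -> ->] // := codeword_inj hab _ _ occ occ';
    [move=> /=; lia | move=> /=; lia | exact: leq_trans le_v (ltnW lt_v)].
have := @size_le_sum_complexity T A S (6 * 2 ^ s * s.+1).+1
  [seq v ij | ij <- scale_pairs m s] SA.
rewrite size_map size_allpairs !size_iota; apply.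
  rewrite map_inj_in_uniq // allpairs_uniq ?iota_uniq //.
  by move=> [? ?] [? ?].
move=> _ /mapP[[i j] ij_in ->]; have [Sv _ [ofs [le_o _]]] := vP _ ij_in.
split=> //; move: le_o; rewrite size_codeword /= => le_o.
have [? ? ?] := bounds _ _ ij_in.
rewrite ltnS (leq_trans _ (leq_trans le_o _)) ?leq_addl //.
by rewrite mulnC leq_mul2r; lia.
Qed.
End Bounds.

Local Open Scope ring_scope.

(** * Polynomial growth and powers of two *)

Section Growth.
Variable R : realType.

Lemma poly_growthP (beta : R) (p : nat -> nat) : poly_growth beta p <->
  exists C N, 0 < C /\
    forall n, (N <= n)%N -> (p n)%:R <= C * n%:R `^ beta.
Proof.
split.
  move=> /eqO_exP[C C0 [N _ pC]]; exists C, N; split=> // n /pC /=.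
  by rewrite normr_nat ger0_norm // powR_ge0.
move=> [C [N [C0 pC]]]; apply/eqO_exP; exists C => //.
near=> n; rewrite normr_nat ger0_norm ?powR_ge0 //; apply: pC.
by near: n; exact: nbhs_infty_ge.
Unshelve. all: by end_near. Qed.

(** The values below the threshold of the asymptotic bound are absorbed in the
    constant, which is legitimate as [L%:R `^ beta >= 1]. *)
Lemma poly_growth_sum (beta : R) (p : nat -> nat) : 0 <= beta ->
  poly_growth beta p -> exists2 C : R, 0 < C &
    forall L, (0 < L)%N ->
      (\sum_(n < L.+1) p n)%:R <= C * L%:R * L%:R `^ beta.
Proof.
move=> b0 /poly_growthP[C [N [C0 pC]]].
pose D := C + (\sum_(n < N) p n)%:R.
have D0 : 0 < D by rewrite ltr_pwDl.
exists (2 * D) => [|L L0]; first by rewrite mulr_gt0.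
have L1 : 1 <= L%:R :> R by rewrite ler1n.
have Lb1 : 1 <= L%:R `^ beta.
  have : 1 `^ beta <= L%:R `^ beta by rewrite ge0_ler_powR ?nnegrE ?ler0n.
  by rewrite powR1.
have pn n : (n <= L)%N -> (p n)%:R <= D * L%:R `^ beta.
  move=> le_nL; case: (leqP N n) => [/pC le_p|lt_n].
    apply: (le_trans le_p); apply: ler_pM; rewrite ?powR_ge0 ?(ltW C0) //.
      by rewrite /D lerDl.
    by rewrite ge0_ler_powR ?nnegrE ?ler0n ?ler_nat.
  apply: (@le_trans _ _ D); last by rewrite ler_peMr // ltW.
  rewrite /D (bigD1 (Ordinal lt_n)) //= natrD.
  by have := ler0n R (\sum_(i < N | i != Ordinal lt_n) p i)%N; lra.
rewrite natr_sum; apply: (@le_trans _ _ (\sum_(n < L.+1) D * L%:R `^ beta)).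
  by apply: ler_sum => n _; apply: pn; rewrite -ltnS.
rewrite sumr_const card_ord -[_ *+ _]mulr_natr.
have -> : 2 * D * L%:R * L%:R `^ beta = D * L%:R `^ beta * (2 * L%:R) by ring.
rewrite ler_pM2l; last by rewrite mulr_gt0 // (lt_le_trans _ Lb1).
by rewrite -natr1; lra.
Qed.

Lemma pow2_powRE (g : R) s : ((2 ^ s)%N%:R : R) `^ g = expR (s%:R * (g * ln 2)).
Proof.
rewrite /powR pnatr_eq0 expn_eq0 /= natrX lnXn // -[ln 2 *+ s]mulr_natl; congr expR; ring.
Qed.

Lemma pow2_powR_ge (g : R) s :
  1 + s%:R * (g * ln 2) <= ((2 ^ s)%N%:R : R) `^ g.
Proof. by rewrite pow2_powRE expR_ge1Dx. Qed.

(** The left side is a polynomial in [s] and the right side an exponential. The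
    latter is the fourth power of [2^(s g / 4)], which is at least linear in [s],
    hence it beats the cube. *)
Lemma pow2_gt_cube (g C : R) k : 0 < g ->
  exists2 s, (k <= s)%N & C * s.+1%:R ^+ 3 < ((2 ^ s)%N%:R : R) `^ g.
Proof.
move=> g0; have l0 : 0 < ln (2 : R) by rewrite ln_gt0 // ltr1n.
pose c := Num.min 1 (g / 4 * ln 2).
have c0 : 0 < c by rewrite lt_min ltr01 mulr_gt0 // divr_gt0.
pose s := (k + Num.truncn (C / c ^+ 4))%N; exists s; first exact: leq_addr.
have sC : C < c ^+ 4 * s.+1%:R.
  rewrite mulrC -ltr_pdivrMr ?exprn_gt0 //.
  by apply: (lt_le_trans (truncnS_gt _)); rewrite ler_nat ltnS leq_addl.
have le_c : c * s.+1%:R <= ((2 ^ s)%N%:R : R) `^ (g / 4).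
  apply: le_trans (pow2_powR_ge _ _).
  rewrite -nat1r mulrDr mulr1 lerD ?ge_min ?lexx //.
  by rewrite mulrC ler_wpM2l // ge_min lexx orbT.
have -> : ((2 ^ s)%N%:R : R) `^ g = (((2 ^ s)%N%:R : R) `^ (g / 4)) ^+ 4.
  by rewrite -powR_mulrn ?powR_ge0 // -powRrM; congr (_ `^ _); field.
apply: (@lt_le_trans _ _ ((c * s.+1%:R) ^+ 4)).
  have -> : (c * s.+1%:R) ^+ 4 = c ^+ 4 * s.+1%:R * s.+1%:R ^+ 3 by ring.
  by rewrite ltr_pM2r // exprn_gt0 // ltr0Sn.
by rewrite lerXn2r // nnegrE ?powR_ge0 // mulr_ge0 // ltW.
Qed.
End Growth.

(** * Choice of the number of pairs *)

Section Word.
Variables (R : realType) (alpha : R).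
Hypotheses (h0 : 0 < alpha) (h1 : alpha < 1).

(** Truncation followed by a successor, so that [width s * s.+1] is at least
    [2^(s alpha)] and exceeds it by at most [s.+1], which is also
    [O(2^(s alpha))]. *)
Definition width s : nat :=
  (Num.truncn ((2 ^ s)%N%:R `^ alpha / s.+1%:R : R)).+1.

Lemma width_le s : (width s <= (2 ^ s).+1)%N.
Proof.
rewrite ltnS -(ler_nat R) (@le_trans _ _ ((2 ^ s)%N%:R `^ alpha / s.+1%:R)) //.
  by rewrite truncn_le divr_ge0 ?powR_ge0.
rewrite ler_pdivrMr ?ltr0Sn // (@le_trans _ _ (2 ^ s)%N%:R) //.
  rewrite -[leRHS]powRr1 // ler_powR ?(ltW h1) //.
  by rewrite ler1n expn_gt0.
by rewrite ler_peMr // ler1n.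
Qed.

Lemma width_ge s : (2 ^ s)%N%:R `^ alpha <= (width s)%:R * s.+1%:R :> R.
Proof. by rewrite -ler_pdivrMr ?ltr0Sn // ltW // truncnS_gt. Qed.

Lemma width_mul_le : exists2 C : R, 0 < C &
  forall s, (width s * s.+1)%N%:R <= C * (2 ^ s)%N%:R `^ alpha.
Proof.
have l0 : 0 < ln (2 : R) by rewrite ln_gt0 // ltr1n.
have al0 : 0 < alpha * ln 2 by rewrite mulr_gt0.
exists (2 + (alpha * ln 2)^-1) => [|s]; first by rewrite addr_gt0 ?invr_gt0.
have := pow2_powR_ge alpha s; set y := _ `^ alpha => le_y.
have y0 : 0 <= y by apply: powR_ge0.
have le_s : s%:R <= y * (alpha * ln 2)^-1 by rewrite ler_pdivlMr //; lra.
have sal : 0 <= s%:R * (alpha * ln 2) by rewrite mulr_ge0 // ltW.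
have le_t : (Num.truncn (y / s.+1%:R))%:R * s.+1%:R <= y.
  by rewrite -ler_pdivlMr ?ltr0Sn // truncn_le divr_ge0.
rewrite natrM /width -/y -[in X in X * _]natr1 mulrDl mul1r mulrDl.
by rewrite [(_)^-1 * y]mulrC; rewrite -natr1 in le_t *; lra.
Qed.

Variables (T : choiceType) (a b : T).
Hypothesis hab : a != b.
Let x := coding_word width a b.

(** The same constant as for one scale suffices for the sum of all scales,
    because [2^(t (2 + alpha))] at least doubles when [t] increases by one. *)
Lemma size_prefix_word_le : exists2 D : R, 0 < D &
  forall t, (size (prefix_word width a b t))%:R <= D * (2 ^ t)%N%:R `^ (2 + alpha).
Proof.
have [C C0 leC] := width_mul_le.
exists (6 * C) => [|t]; first by rewrite mulr_gt0.
have p0 s : 0 < (2 ^ s)%N%:R :> R by rewrite ltr0n expn_gt0.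
have powE s : (2 ^ s)%N%:R `^ (2 + alpha) =
    (2 ^ s)%N%:R * (2 ^ s)%N%:R * (2 ^ s)%N%:R `^ alpha :> R.
  by rewrite powRD ?(gt_eqF (p0 s)) ?implybT // powR_mulrn ?ltW // expr2.
elim: t => [|t IH].
  by rewrite /prefix_word /= mulr_ge0 ?powR_ge0 // mulr_ge0 // ltW.
have := size_prefix_wordS a b (width_le t); rewrite -(ler_nat R).
move=> /le_trans; apply; rewrite natrD.
apply: (@le_trans _ _ (2 * (6 * C * (2 ^ t)%N%:R `^ (2 + alpha)))).
  rewrite [leRHS]mulr_natl mulr2n.
  rewrite lerD // powE natrM !natrM.
  have := leC t; rewrite natrM => le_t.
  have := @ler_wpM2l R (6 * ((2 ^ t)%N%:R * (2 ^ t)%N%:R)) _ _ _ le_t.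
  by rewrite !mulr_ge0 // => /(_ isT); lra.
rewrite mulrCA; apply: ler_wpM2l; first by rewrite mulr_ge0 // ltW.
have mono : (2 ^ t)%N%:R `^ alpha <= (2 ^ t.+1)%N%:R `^ alpha :> R.
  by rewrite ge0_ler_powR ?nnegrE ?ler0n ?(ltW h0) // ler_nat leq_exp2l.
rewrite !powE; have := powR_ge0 (2 ^ t)%N%:R alpha.
move: mono; rewrite {2 3}expnS natrM.
set y := _ `^ alpha; set z := _ `^ alpha; set p := (2 ^ t)%N%:R => le_yz y0.
have pp0 : 0 <= p * p by rewrite mulr_ge0 ?ler0n.
have : p * p * y <= p * p * z by exact: ler_wpM2l.
have : 0 <= p * p * y by exact: mulr_ge0.
lra.
Qed.

(** For [2^t <= n < 2^(t+1)] the prefix made of the scales up to [t] has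
    length of order [(2n)^(2 + alpha)] at most. *)
Lemma coding_word_growth : poly_growth (2 + alpha) (complexity (Fac x)).
Proof.
have [D D0 leD] := size_prefix_word_le.
apply/poly_growthP; exists (D * 2 `^ (2 + alpha) + 2), 1%N.
split=> [|n n1]; first by rewrite addr_gt0 // mulr_gt0 // powR_gt0.
have /andP[le_n lt_n] := trunc_log_bounds (isT : (1 < 2)%N) n1.
set t := trunc_log 2 n in le_n lt_n.
have := complexity_coding_word (m := width) (fun=> isT) hab (ltnW lt_n).
rewrite -/x -(ler_nat R) => /le_trans; apply; rewrite natrD mulrDl lerD //.
  apply: (le_trans (leD _)); rewrite -mulrA ler_pM2l // -powRM ?ler0n //.
  rewrite ge0_ler_powR ?nnegrE ?mulr_ge0 ?ler0n ?addr_ge0 ?(ltW h0) //.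
  by rewrite -natrM ler_nat expnS leq_mul2l le_n orbT.
have n1' : 1 <= n%:R :> R by rewrite ler1n.
have : n%:R `^ 1 <= n%:R `^ (2 + alpha) :> R.
  by rewrite ler_powR // (@le_trans _ _ 2) ?ler1n ?lerDl ?(ltW h0).
by rewrite powRr1 ?ler0n // -natr1; lra.
Qed.

(** With [p = 2^s], comparing the two counts of words of [S] would give
    [p^alpha <= 36 C (s+1)^3 p^beta], where the exponents [beta] of [6] and [s+1]
    are replaced by [1]. *)
Lemma coding_word_not_sub (beta : R) k (S : language T) : 0 <= beta ->
  beta < alpha -> lang_class beta S -> ~ Fac x `<=` lang_pow S k.
Proof.
move=> b0 lt_ba [[A [_ SA]] gS] Sk.
have [C C0 leC] := poly_growth_sum b0 gS.
have g0 : 0 < alpha - beta by rewrite subr_gt0.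
have [s le_s] := pow2_gt_cube (36 * C) (4 * k) g0.
have := sum_complexity_ge (m := width) (fun=> isT) hab SA Sk le_s (width_le s).
rewrite -(ler_nat R) => /le_trans/(_ (leC _ _)).
rewrite !muln_gt0 expn_gt0 /= => /(_ isT).
have := width_ge s.
have p0 : 0 < (2 ^ s)%N%:R :> R by rewrite ltr0n expn_gt0.
rewrite !natrM; set p := (2 ^ s)%N%:R in p0 *; set z := s.+1%:R; set w := (width s)%:R.
have z1 : 1 <= z by rewrite ler1n.
have z0 : 0 < z by rewrite ltr0n.
have le1 y : 1 <= y -> y `^ beta <= y.
  move=> y1; rewrite -[leRHS]powRr1 ?(le_trans _ y1) // ler_powR //.
  by rewrite ltW // (lt_trans lt_ba).
rewrite !powRM ?mulr_ge0 // ?(ltW p0) ?(ltW z0) //.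
have -> : p `^ alpha = p `^ beta * p `^ (alpha - beta).
  by rewrite -powRD ?(gt_eqF p0) ?implybT //; congr (_ `^ _); ring.
have := le1 6 ltac:(lra); have := le1 z z1.
have := powR_ge0 6 beta; have := powR_ge0 z beta; have := powR_gt0 beta p0.
set q := p `^ beta; set z' := z `^ beta; set c := 6 `^ beta; set r := p `^ (alpha - beta).
move=> q0 z'0 c0 le_z le_c le_w le_pw lt_r.
have le_cz : c * z' <= 6 * z by exact: ler_pM.
have : p * (36 * C * z ^+ 3 * q) < p * (q * r).
  by rewrite ltr_pM2l // mulrC ltr_pM2l.
apply/negP; rewrite -leNgt.
apply: (@le_trans _ _ (p * (w * z))); first by rewrite ler_pM2l.
apply: (@le_trans _ _ (C * (6 * p * z) * (c * q * z') * z)).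
  by rewrite mulrA ler_pM2r.
have -> : C * (6 * p * z) * (c * q * z') * z =
  C * 6 * p * z * q * z * (c * z') by ring.
have -> : p * (36 * C * z ^+ 3 * q) = C * 6 * p * z * q * z * (6 * z) by ring.
by rewrite ler_pM2l // !mulr_gt0.
Qed.

Lemma cost_coding_word_ge : (alpha%:E <= cost R x)%E.
Proof.
apply/ereal_infP => _ [beta [b0 dim] <-]; rewrite lee_fin leNgt.
apply/negP => lt_ba.
have [_ [k [_ [S SL Sk]] _] _] := ereal_inf_lt dim.
exact: coding_word_not_sub b0 lt_ba SL Sk.
Qed.
End Word.

Theorem corollary6p3 (R : realType) (T : choiceType) (a b : T) (hab : a != b)
    (alpha : R) (h0 : 0 < alpha) (h1 : alpha < 1) :
  exists x : nat -> T,
    [/\ forall n, x n \in [:: a; b],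
        poly_growth (2 + alpha) (complexity (Fac x))
      & (alpha%:E <= cost R x)%E].
Proof.
exists (coding_word (width alpha) a b); split.
- exact: coding_word_mem.
- exact: coding_word_growth.
- exact: cost_coding_word_ge.
Qed.
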